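(* Let $\mathcal{F}$ be a type of algebras, let $\leq_{\mathcal{F}_0}$ be a partial order on the set $\mathcal{F}_0$ of constant symbols, and let $\mathcal{F}\text{-}\mathbf{Oalg}^0_{\leq}$ be the variety of all ordered $\mathcal{F}$-algebras satisfying the inequalities $c\leq d$ for all $c,d\in\mathcal{F}_0$ with $c\leq_{\mathcal{F}_0}d$. Then every epimorphism in $\mathcal{F}\text{-}\mathbf{Oalg}^0_{\leq}$ is surjective.
   Context: An ordered $\mathcal{F}$-algebra is a triple $\mathbf{A}=(A,\mathcal{F}^{\mathbf{A}},\leq_A)$ with $(A,\mathcal{F}^{\mathbf{A}})$ an $\mathcal{F}$-algebra and $\leq_A$ a partial order on $A$ such that every basic operation is monotone (in all arguments jointly). A homomorphism of ordered $\mathcal{F}$-algebras is a monotone map that is a homomorphism of the underlying algebras. The variety is regarded as a category with all homomorphisms of ordered $\mathcal{F}$-algebras between its members as morphisms; an epimorphism is a right-cancellative morphism of this category. *)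

(* Defs.v *)
From Stdlib Require Import Relations Vector FinFun.

Set Implicit Arguments.

(* [F n] is the set of [n]-ary operation symbols, so that [F 0] is the set of
   constant symbols. *)
Definition signature := nat -> Type.

(* The carrier may be empty when [F 0] is. *)
Record oalgebra (F : signature) := OAlgebra {
  carrier :> Type;
  op : forall n, F n -> Vector.t carrier n -> carrier;
  le : relation carrier;
  le_order : order carrier le;
  op_monotone : forall n (w : F n) (x y : Vector.t carrier n),
    Vector.Forall2 le x y -> le (op w x) (op w y)
}.

Arguments op {F} A {n} w x : rename.
Arguments le {F} A x y : rename.

Definition const {F : signature} (A : oalgebra F) (c : F 0) : A :=
  op A c (Vector.nil A).

Record hom (F : signature) (A B : oalgebra F) := Hom {
  hom_fun :> A -> B;
  hom_monotone : forall x y : A, le A x y -> le B (hom_fun x) (hom_fun y);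
  hom_op : forall n (w : F n) (x : Vector.t A n),
    hom_fun (op A w x) = op B w (Vector.map hom_fun x)
}.

(* Right-cancellability in the full subcategory of ordered algebras whose
   objects are the members of [K].  Equality of morphisms is equality of the
   underlying maps, written pointwise. *)
Definition epimorphism (F : signature) (K : oalgebra F -> Prop)
    (A B : oalgebra F) (f : hom A B) : Prop :=
  forall C : oalgebra F, K C -> forall g h : hom B C,
    (forall a : A, g (f a) = h (f a)) -> forall b : B, g b = h b.

Definition Oalg0 (F : signature) (leF0 : relation (F 0)) (A : oalgebra F) : Prop :=
  forall c d : F 0, leF0 c d -> le A (const A c) (const A d).

(* Main.v *)
(** Glue two copies of [B] along the image of [f], and order the result by
    [(s, x) <= (t, y)] iff [x <= y] and, when [s <> t], some [f a] lies between
    [x] and [y].  The subsets of this preorder form an ordered algebra in which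
    the value of [w] at [X1, ..., Xn] is the down-closure of all
    [(s, w(y1, ..., yn))] with [(s, yi)] in [Xi].  As [f] preserves the
    operations, interpolants for the arguments yield one for the values, so each
    copy of [B] maps homomorphically by principal down-sets.  These two
    homomorphisms agree exactly on the image of [f]. *)

Require Import Defs.
From Stdlib Require Import Relations Vector FinFun.
From Stdlib Require Import FunctionalExtensionality PropExtensionality.

Lemma Forall2_nth_iff {T U : Type} (R : T -> U -> Prop) {n : nat}
    (x : Vector.t T n) (y : Vector.t U n) :
  Vector.Forall2 R x y <-> forall i, R (Vector.nth x i) (Vector.nth y i).
Proof.
split.
- induction 1 as [|n a b x y hab hxy IH]; intros i.
  + inversion i.
  + apply (Fin.caseS' i); [exact hab | exact IH].
- revert n x y; apply (Vector.rect2 (fun n x y =>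
    (forall i, R (Vector.nth x i) (Vector.nth y i)) -> Vector.Forall2 R x y)).
  + constructor.
  + intros n x y IH a b h; constructor.
    * exact (h Fin.F1).
    * apply IH; intros i; exact (h (Fin.FS i)).
Qed.

(** Induction on the vectors collects the interpolants into one vector, so no choice principle is
    involved. *)
Lemma Forall2_interpolant {S T U : Type} (P : S -> U -> Prop)
    (Q : U -> T -> Prop) {V : Type} (f : V -> U) {n : nat}
    (x : Vector.t S n) (y : Vector.t T n) :
  Vector.Forall2 (fun a b => exists v, P a (f v) /\ Q (f v) b) x y ->
  exists z, Vector.Forall2 P x (Vector.map f z) /\
            Vector.Forall2 Q (Vector.map f z) y.
Proof.
induction 1 as [|n a b x y [v [hP hQ]] _ [z [hPz hQz]]].
- exists (Vector.nil V); split; constructor.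
- exists (Vector.cons V v n z); split; constructor; assumption.
Qed.

(** Only a preorder: [(false, f a)] and [(true, f a)] lie below each other. No quotient is formed;
    passing to down-sets identifies them. *)
Definition glued_le {F : signature} {A B : oalgebra F} (f : hom A B)
    (p q : bool * B) : Prop :=
  le B (snd p) (snd q) /\
  (fst p = fst q \/ exists a : A, le B (snd p) (f a) /\ le B (f a) (snd q)).

Lemma glued_le_refl {F : signature} {A B : oalgebra F} (f : hom A B) p :
  glued_le f p p.
Proof. split; [apply (ord_refl _ _ (le_order B)) | now left]. Qed.

Lemma glued_le_trans {F : signature} {A B : oalgebra F} (f : hom A B) p q r :
  glued_le f p q -> glued_le f q r -> glued_le f p r.
Proof.
pose proof (ord_trans _ _ (le_order B)) as tr.
intros [hpq [epq | [a [hpa haq]]]] [hqr [eqr | [a' [hqa har]]]];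
  (split; [now apply tr with (snd q) |]).
- left; congruence.
- right; exists a'; split; [now apply tr with (snd q) | assumption].
- right; exists a; split; [assumption | now apply tr with (snd q)].
- right; exists a; split; [assumption | now apply tr with (snd q)].
Qed.

(** The tags [s] and [t] are shared by all coordinates. If they differ, every coordinate has an
    interpolant [f z_i], and [f (w z)] interpolates the values. *)
Lemma glued_le_op {F : signature} {A B : oalgebra F} (f : hom A B) (s t : bool)
    {n : nat} (w : F n) (x y : Vector.t B n) :
  Vector.Forall2 (fun a b => glued_le f (s, a) (t, b)) x y ->
  glued_le f (s, op B w x) (t, op B w y).
Proof.
intros h; split; simpl.
- apply op_monotone, Forall2_nth_iff; intros i.
  apply (proj1 (proj1 (Forall2_nth_iff _ _ _) h i)).
- destruct (Bool.bool_dec s t) as [e | ne]; [now left | right].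
  destruct (Forall2_interpolant (le B) (le B) f x y)
    as [z [hxz hzy]].
  + apply Forall2_nth_iff; intros i.
    destruct (proj1 (Forall2_nth_iff _ _ _) h i) as [_ [e | ha]];
      [contradiction | exact ha].
  + exists (op A w z); rewrite hom_op; split; now apply op_monotone.
Qed.

Definition subset_op {F : signature} {A B : oalgebra F} (f : hom A B)
    {n : nat} (w : F n) (X : Vector.t (bool * B -> Prop) n) : bool * B -> Prop :=
  fun p => exists s y,
    Vector.Forall2 (fun b (Xi : bool * B -> Prop) => Xi (s, b)) y X /\
    glued_le f p (s, op B w y).

Lemma inclusion_order (T : Type) :
  order (T -> Prop) (fun X Y => forall p, X p -> Y p).
Proof.
split.
- intros X p; trivial.
- intros X Y Z hXY hYZ p hp; auto.
(* Antisymmetry up to Leibniz equality is where the extensionality axioms enter. *)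
- intros X Y hXY hYX; apply functional_extensionality; intros p.
  apply propositional_extensionality; split; auto.
Qed.

Lemma subset_op_monotone {F : signature} {A B : oalgebra F} (f : hom A B)
    {n : nat} (w : F n) (X Y : Vector.t (bool * B -> Prop) n) :
  Vector.Forall2 (fun X Y => forall p, X p -> Y p) X Y ->
  forall p, subset_op f w X p -> subset_op f w Y p.
Proof.
intros hXY p [s [y [hy hp]]]; exists s, y; split; [| exact hp].
apply Forall2_nth_iff; intros i.
apply (proj1 (Forall2_nth_iff _ _ _) hXY i).
apply (proj1 (Forall2_nth_iff _ _ _) hy i).
Qed.

Definition subset_algebra {F : signature} {A B : oalgebra F} (f : hom A B) :
    oalgebra F :=
  {| carrier := bool * B -> Prop;
     op := @subset_op F A B f;
     le := fun X Y => forall p, X p -> Y p;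
     le_order := inclusion_order (bool * B);
     op_monotone := @subset_op_monotone F A B f |}.

Definition downset {F : signature} {A B : oalgebra F} (f : hom A B) (s : bool)
    (b : B) : subset_algebra f :=
  fun p => glued_le f p (s, b).

Lemma downset_monotone {F : signature} {A B : oalgebra F} (f : hom A B)
    (s : bool) (x y : B) :
  le B x y -> le (subset_algebra f) (downset f s x) (downset f s y).
Proof.
intros hxy p hp; apply glued_le_trans with (1 := hp).
split; [exact hxy | now left].
Qed.

Lemma downset_op {F : signature} {A B : oalgebra F} (f : hom A B) (s : bool)
    {n : nat} (w : F n) (x : Vector.t B n) :
  downset f s (op B w x) =
  op (subset_algebra f) w (Vector.map (downset f s) x).
Proof.
apply (ord_antisym _ _ (le_order (subset_algebra f))).
- intros p hp; exists s, x; split; [| exact hp].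
  apply Forall2_nth_iff; intros i.
  rewrite (Vector.nth_map _ _ _ _ eq_refl); apply glued_le_refl.
(* The tag [t] may differ from [s], as it can when [w] is a constant; [glued_le_op] allows for
   this. *)
- intros p [t [y [hy hp]]]; apply glued_le_trans with (1 := hp).
  apply glued_le_op, Forall2_nth_iff; intros i.
  pose proof (proj1 (Forall2_nth_iff _ _ _) hy i) as hi.
  now rewrite (Vector.nth_map _ _ _ _ eq_refl) in hi.
Qed.

Definition downset_hom {F : signature} {A B : oalgebra F} (f : hom A B)
    (s : bool) : hom B (subset_algebra f) :=
  {| hom_fun := downset f s;
     hom_monotone := @downset_monotone F A B f s;
     hom_op := @downset_op F A B f s |}.

(** The point [f a] is its own interpolant between the two copies. *)
Lemma downset_image {F : signature} {A B : oalgebra F} (f : hom A B)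
    (s t : bool) (a : A) :
  le (subset_algebra f) (downset f s (f a)) (downset f t (f a)).
Proof.
intros p hp; apply glued_le_trans with (1 := hp).
pose proof (ord_refl _ _ (le_order B) (f a)).
split; [assumption | right; now exists a].
Qed.

(** The defining inequalities contain no variables, so they pass along any homomorphism, surjective
    or not. *)
Lemma Oalg0_hom {F : signature} {leF0 : relation (F 0)} {B C : oalgebra F}
    (g : hom B C) : Oalg0 leF0 B -> Oalg0 leF0 C.
Proof.
intros hB c d hcd.
pose proof (hom_monotone g _ _ (hB c d hcd)) as h.
unfold Defs.const in h; now rewrite !hom_op in h.
Qed.

Theorem corollary3 (F : signature) (leF0 : relation (F 0))
    (leF0_order : order (F 0) leF0)
    (A B : oalgebra F) (hA : Oalg0 leF0 A) (hB : Oalg0 leF0 B)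
    (f : hom A B) (hf : epimorphism (Oalg0 leF0) f) :
  Surjective f.
Proof.
intros b.
assert (e : downset f false b = downset f true b).
{ apply (hf _ (Oalg0_hom (downset_hom f true) hB)
            (downset_hom f false) (downset_hom f true)).
  intros a; apply (ord_antisym _ _ (le_order (subset_algebra f)));
    apply downset_image. }
assert (h : downset f true b (false, b)).
{ rewrite <- e; apply glued_le_refl. }
(* The tags [false] and [true] differ, so some [f a] satisfies [b <= f a <= b]. *)
destruct h as [_ [h | [a [hba hab]]]]; [discriminate |].
exists a; now apply (ord_antisym _ _ (le_order B)).
Qed.
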